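(* Let $A \in M_{2n\times 2n}(\mathbb{C})$ be a normal matrix that is Hamiltonian or skew-Hamiltonian. Then $A$ is symplectic diagonalizable if and only if it is unitary-symplectic diagonalizable.
   Context: $M_{2n\times 2n}(\mathbb{C})$ is the space of complex $2n\times 2n$ matrices and $A^H=\overline{A}^T$ is the Hermitian transpose. $A$ is normal if $A^HA=AA^H$. $J_{2n} = \begin{bmatrix} 0 & I_n \\ -I_n & 0\end{bmatrix}$. A matrix $A$ is skew-Hamiltonian if $J_{2n}^T A^H J_{2n} = A$, and Hamiltonian if $J_{2n}^T A^H J_{2n} = -A$. A matrix $S \in M_{2n\times 2n}(\mathbb{C})$ is symplectic if $S^H J_{2n} S = J_{2n}$, and unitary-symplectic if it is both unitary and symplectic. $A$ is symplectic diagonalizable (respectively unitary-symplectic diagonalizable) if there is a symplectic (respectively unitary-symplectic) matrix $S$ such that $S^{-1}AS$ is diagonal. *)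

(* Defs.v *)
From mathcomp Require Import all_boot all_order all_algebra.
From mathcomp Require Import complex reals.

Set Implicit Arguments.
Unset Strict Implicit.
Unset Printing Implicit Defensive.

Import GRing.Theory Num.Theory.

Local Open Scope ring_scope.

Section Symplectic.
Variables (C : numClosedFieldType) (n : nat).
Implicit Types A S : 'M[C]_(n + n).

Definition hermitian_transpose A : 'M[C]_(n + n) := map_mx Num.conj A^T.

Definition J2n : 'M[C]_(n + n) := block_mx 0 1%:M (- 1%:M) 0.

Definition skew_Hamiltonian A : Prop :=
  J2n^T *m hermitian_transpose A *m J2n = A.

Definition Hamiltonian A : Prop :=
  J2n^T *m hermitian_transpose A *m J2n = - A.

(* The conjugate-transpose (sesquilinear) notion, not S^T J S = J. *)
Definition symplectic S : Prop :=
  hermitian_transpose S *m J2n *m S = J2n.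

Definition unitary_symplectic S : Prop :=
  S \is unitarymx /\ symplectic S.

(* A symplectic S is invertible because J2n is, so invmx S is its inverse. *)
Definition symplectic_diagonalizable A : Prop :=
  exists S, symplectic S /\ is_diag_mx (invmx S *m A *m S).

Definition unitary_symplectic_diagonalizable A : Prop :=
  exists S, unitary_symplectic S /\ is_diag_mx (invmx S *m A *m S).

End Symplectic.

(* Main.v *)
Require Import Defs.
From mathcomp Require Import all_boot all_order all_algebra.
From mathcomp Require Import complex reals.

(** If [S^-1 A S = D] is diagonal with [S] symplectic, take the polar
    decomposition [S = U P], [P = (S^H S)^(1/2)].  As [S^H S] is itself
    symplectic and [P] is a function of it, [P] is symplectic, hence so is the
    unitary factor [U].  As [A] is normal, [A S = S D] gives [A^H S = S D^H];
    hence [S^H S], and therefore [P], commutes with [D], and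
    [U^-1 A U = P D P^-1 = D]. *)

Import Order.TTheory GRing.Theory Num.Theory.

Local Open Scope ring_scope.
Local Open Scope sesquilinear_scope.

Section NumClosed.

Set Implicit Arguments.
Unset Strict Implicit.

(** Entrywise the hypothesis reads [d_i X_ij = X_ij e_j], so [d_i = e_j] wherever [X_ij] is nonzero,
    and [f] preserves this equality. It is applied with conjugation and with [sqrtC]. *)
Lemma diag_mx_intertwine (F : idomainType) (f : F -> F) m n
    (d : 'rV[F]_m) (e : 'rV[F]_n) (X : 'M[F]_(m, n)) :
  diag_mx d *m X = X *m diag_mx e ->
  diag_mx (map_mx f d) *m X = X *m diag_mx (map_mx f e).
Proof.
rewrite !mul_diag_mx !mul_mx_diag => /matrixP dXe.
apply/matrixP => i j; have := dXe i j; rewrite !mxE mulrC.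
have [->|X_neq0] := eqVneq (X i j) 0; first by move=> _; rewrite mulr0 mul0r.
by move=> /(mulfI X_neq0) ->; rewrite mulrC.
Qed.

Variable C : numClosedFieldType.

Lemma trmxC_mul m n p (A : 'M[C]_(m, n)) (B : 'M[C]_(n, p)) :
  (A *m B)^t* = B^t* *m A^t*.
Proof. by rewrite trmx_mul map_mxM. Qed.

Lemma trmxC_diag n (d : 'rV[C]_n) :
  (diag_mx d)^t* = diag_mx (map_mx Num.conj d).
Proof. by rewrite tr_diag_mx map_diag_mx. Qed.

Lemma normalmx_spectral n (A : 'M[C]_n) : A \is normalmx ->
  exists (V : 'M[C]_n) (d : 'rV[C]_n), V \is unitarymx /\ A = V^t* *m diag_mx d *m V.
Proof.
move=> /orthomx_spectralP; have uV := spectral_unitarymx A.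
by rewrite invmx_unitary // => ->; exists (spectralmx A), (spectral_diag A).
Qed.

Lemma mul_trmxC_unitary n (V : 'M[C]_n) : V \is unitarymx -> V^t* *m V = 1%:M.
Proof. by move/unitarymxP/mulmx1C. Qed.

(* Fuglede's theorem, for a diagonal matrix on the right. *)
Lemma normalmx_intertwine_trmxC n (A S : 'M[C]_n) (e : 'rV[C]_n) :
  A \is normalmx -> A *m S = S *m diag_mx e ->
  A^t* *m S = S *m (diag_mx e)^t*.
Proof.
move=> /normalmx_spectral [V [d [uV ->]]] ASe.
have VSe : diag_mx d *m (V *m S) = V *m S *m diag_mx e.
  by rewrite -[RHS]mulmxA -ASe !mulmxA (unitarymxP uV) mul1mx.
rewrite !trmxC_mul trmxCK !trmxC_diag -!mulmxA.
by rewrite (diag_mx_intertwine Num.conj VSe) !mulmxA mul_trmxC_unitary ?mul1mx.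
Qed.

(** The polar factor, obtained by taking square roots of the eigenvalues of [S^H S]. The third
    clause will be used with the diagonal form of [A], the fourth with [X = J2n], where it makes [P]
    symplectic. *)
Lemma gram_sqrt n (S : 'M[C]_n) : exists P : 'M[C]_n,
  [/\ P^t* = P, P *m P = S^t* *m S,
      forall X, S^t* *m S *m X = X *m (S^t* *m S) -> P *m X = X *m P
    & forall X, S^t* *m S *m X *m (S^t* *m S) = X -> P *m X *m P = X].
Proof.
have /normalmx_spectral [V [d [uV SS]]] : S^t* *m S \is normalmx.
  by apply/normalmxP; rewrite trmxC_mul trmxCK.
have VVC := unitarymxP uV; have VCV := mul_trmxC_unitary uV.
(* [d_i] is a diagonal entry of the Gram matrix of [S V^H], hence a sum of squared moduli. *)
have d_ge0 i : 0 <= d 0 i.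
  have /matrixP/(_ i i) : (S *m V^t*)^t* *m (S *m V^t*) = diag_mx d.
    rewrite trmxC_mul trmxCK mulmxA -(mulmxA V) SS !mulmxA VVC mul1mx.
    by rewrite -mulmxA VVC mulmx1.
  rewrite [X in _ = X]mxE eqxx mulr1n => <-; rewrite mxE sumr_ge0 // => j _.
  by rewrite mxE mxE mulrC mul_conjC_ge0.
pose r := map_mx sqrtC d; pose P := V^t* *m diag_mx r *m V.
(* Where [Y_ij] is nonzero, [d_i d_j = 1]; by nonnegativity the square roots multiply to
   [sqrtC 1 = 1]. *)
have sqrt_scaling (Y : 'M_n) : diag_mx d *m Y *m diag_mx d = Y ->
    diag_mx r *m Y *m diag_mx r = Y.
  move=> dY; apply/matrixP => i j; have /matrixP/(_ i j) := dY.
  rewrite !mul_diag_mx !mul_mx_diag !mxE mulrAC => dYij.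
  have [->|Y_neq0] := eqVneq (Y i j) 0; first by rewrite mulr0 mul0r.
  have dd1 : d 0 i * d 0 j = 1 by apply: (mulIf Y_neq0); rewrite mul1r.
  by rewrite mulrAC -sqrtCM ?nnegrE // dd1 sqrtC1 mul1r.
exists P; split.
- rewrite /P !trmxC_mul trmxCK trmxC_diag !mulmxA; congr (_ *m diag_mx _ *m _).
  apply/rowP => i; rewrite !mxE; apply: CrealP.
  by rewrite ger0_real ?sqrtC_ge0.
- rewrite SS /P !mulmxA -(mulmxA _ V) VVC mulmx1 -(mulmxA (V^t*)) mulmx_diag.
  by congr (_ *m diag_mx _ *m _); apply/rowP => i; rewrite !mxE -expr2 sqrtCK.
- move=> X; rewrite SS => comX.
  have /(diag_mx_intertwine sqrtC) rY :
      diag_mx d *m (V *m X *m V^t*) = V *m X *m V^t* *m diag_mx d.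
    have := congr1 (fun Z => V *m Z *m V^t*) comX.
    by rewrite !mulmxA VVC mul1mx => ->; rewrite -[LHS]mulmxA VVC mulmx1.
  have := congr1 (fun Z => V^t* *m Z *m V) rY.
  rewrite !mulmxA VCV mul1mx => <-.
  by rewrite -[RHS]mulmxA VCV mulmx1.
- move=> X; rewrite SS => sympX.
  pose Y := V *m X *m V^t*.
  have dY : diag_mx d *m Y *m diag_mx d = Y.
    rewrite /Y -[in RHS]sympX !mulmxA VVC mul1mx.
    by rewrite -[RHS]mulmxA VVC mulmx1.
  have := congr1 (fun Z => V^t* *m Z *m V) (sqrt_scaling _ dY).
  rewrite /Y /P !mulmxA VCV mul1mx.
  by rewrite -[X in _ = X -> _]mulmxA VCV mulmx1.
Qed.

Lemma J2n_sq n : J2n C n *m J2n C n = - 1%:M.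
Proof.
rewrite /J2n mulmx_block !mulmx0 !mul0mx mulmx1 mulmxN mulmx1 !add0r !addr0.
by rewrite (scalar_mx_block n n 1) opp_block_mx !oppr0.
Qed.

(** As [J^2 = -1], the matrix [- J S^H J] is a left inverse of [S]. *)
Lemma symplectic_unit n (S : 'M[C]_(n + n)) : symplectic S -> S \in unitmx.
Proof.
move=> sS; have: - J2n C n *m (S^t* *m J2n C n) *m S = 1%:M.
  by rewrite -mulmxA sS mulNmx J2n_sq opprK.
by move=> /mulmx1_unit [].
Qed.

(** The left inverse [- J S^H J] is also a right inverse; multiplying [- S J S^H J = 1] by [J] on
    the right gives the claim. *)
Lemma symplectic_trmxC n (S : 'M[C]_(n + n)) :
  symplectic S -> S *m J2n C n *m S^t* = J2n C n.
Proof.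
move=> sS; have: - J2n C n *m (S^t* *m J2n C n) *m S = 1%:M.
  by rewrite -mulmxA sS mulNmx J2n_sq opprK.
move=> /mulmx1C; rewrite mulNmx mulmxN !mulmxA => SJSJ.
have := congr1 (fun Z => Z *m J2n C n) SJSJ.
by rewrite mulNmx -(mulmxA _ (J2n C n) (J2n C n)) J2n_sq mulmxN mulmx1 opprK mul1mx.
Qed.

Lemma normalmx_symplectic_diagonalizable n (A : 'M[C]_(n + n)) :
  A \is normalmx -> symplectic_diagonalizable A ->
  unitary_symplectic_diagonalizable A.
Proof.
move=> nA [S [sS /diag_mxP [e De]]].
have uS := symplectic_unit sS.
have AS : A *m S = S *m diag_mx e by rewrite -De !mulmxA mulmxV ?mul1mx.
have SA : S^t* *m A = diag_mx e *m S^t*.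
  have := congr1 (fun Z => Z^t*) (normalmx_intertwine_trmxC nA AS).
  by rewrite !trmxC_mul !trmxCK.
have [P [hP PP comP sympP]] := gram_sqrt S.
have uP : P \in unitmx.
  have: P *m P \in unitmx by rewrite PP unitmx_mul map_unitmx unitmx_tr uS.
  by rewrite unitmx_mul => /andP [].
(* [S^H S D = S^H A S = D S^H S], where [D = diag_mx e]. *)
have PD : P *m diag_mx e = diag_mx e *m P.
  by apply: comP; rewrite -mulmxA -AS !mulmxA SA.
have PJP : P *m J2n C n *m P = J2n C n.
  (* [S^H (S J S^H) S = S^H J S = J]. *)
  apply: sympP; rewrite !mulmxA -(mulmxA _ S) -(mulmxA _ (S *m _)).
  by rewrite symplectic_trmxC.
have hP' : (invmx P)^t* = invmx P by rewrite trmx_inv map_invmx hP.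
pose U := S *m invmx P.
have UU : U^t* *m U = 1%:M.
  rewrite trmxC_mul hP' mulmxA -(mulmxA _ _ S) -PP mulKmx //.
  by rewrite mulmxV.
have uU : U \is unitarymx by apply/unitarymxP/mulmx1C.
exists U; split; first split=> //.
  (* [U^H J U = P^-1 (S^H J S) P^-1 = P^-1 J P^-1], which is [J] because [J = P J P]. *)
  rewrite /symplectic -[hermitian_transpose U]/(U^t*) trmxC_mul hP' !mulmxA.
  rewrite -(mulmxA _ _ (J2n C n)) -(mulmxA _ _ S) [S^t* *m _ *m S]sS.
  by rewrite -{1}PJP !mulmxA mulVmx // mul1mx mulmxK.
(* [A U = S D P^-1 = S P^-1 D = U D], since [D] commutes with [P^-1]. *)
have -> : invmx U *m A *m U = diag_mx e; last exact: diag_mx_is_diag.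
rewrite -mulmxA [A *m U]mulmxA AS -(mulmxA S).
have -> : diag_mx e *m invmx P = invmx P *m diag_mx e.
  by rewrite -[in LHS](mulKmx uP (diag_mx e)) PD -!mulmxA mulmxV // mulmx1.
by rewrite (mulmxA S) mulKmx // unitarymx_unit.
Qed.

End NumClosed.

Local Open Scope complex_scope.

Theorem theorem3 (R : realType) (n : nat) (A : 'M[R[i]]_(n + n)) :
  A \is normalmx ->
  Hamiltonian A \/ skew_Hamiltonian A ->
  (symplectic_diagonalizable A <-> unitary_symplectic_diagonalizable A).
Proof.
move=> nA _; split; first exact: normalmx_symplectic_diagonalizable.
by move=> [S [[_ sS] diagS]]; exists S.
Qed.
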